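(* Let $M \xrightarrow{R} A$ be a relative Rota-Baxter algebra and let $(N \xrightarrow{S} B, l, r)$ be a bimodule over it. Then there is a one-to-one correspondence between $\mathrm{Ext}(M \xrightarrow{R} A; N \xrightarrow{S} B)$, the set of isomorphism classes of abelian extensions of $M \xrightarrow{R} A$ by the $2$-term chain complex $N \xrightarrow{S} B$ whose induced bimodule structure on $N \xrightarrow{S} B$ is the prescribed one $(N\xrightarrow{S}B,l,r)$, and the second cohomology group $H^2_{\mathsf{rRB}}(M \xrightarrow{R} A; N \xrightarrow{S} B)$.
   Context: All vector spaces, (multi)linear maps and tensor products are over a field $\mathbf{k}$ of characteristic $0$. Associative algebras need not be unital. **Basic notions.** For an associative algebra $A$ with product $\mu(a,a')=a\cdot a'$, an $A$-bimodule is a vector space $M$ with bilinear maps $l_M:A\otimes M\to M$, $(a,m)\mapsto a\cdot_M m$, and $r_M:M\otimes A\to M$, $(m,a)\mapsto m\cdot_M a$, with $(a\cdot a')\cdot_M m=a\cdot_M(a'\cdot_M m)$, $(a\cdot_M m)\cdot_M a'=a\cdot_M(m\cdot_M a')$, $(m\cdot_M a)\cdot_M a'=m\cdot_M(a\cdot a')$. A relative Rota-Baxter algebra $M\xrightarrow{R}A$ consists of an associative algebra $A$, an $A$-bimodule $M$ and a linear map $R:M\to A$ with $R(m)\cdot R(m')=R(R(m)\cdot_M m'+m\cdot_M R(m'))$ for all $m,m'\in M$. A morphism from $M\xrightarrow{R}A$ to $N\xrightarrow{S}B$ is a pair $(\phi,\psi)$ of an algebra morphism $\phi:A\to B$ and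 a linear map $\psi:M\to N$ with $\psi(a\cdot_M m)=\phi(a)\cdot_N\psi(m)$, $\psi(m\cdot_M a)=\psi(m)\cdot_N\phi(a)$, $\phi\circ R=S\circ\psi$; it is an isomorphism if $\phi,\psi$ are linear isomorphisms. A $2$-term chain complex $N\xrightarrow{S}B$ is just a linear map $S:N\to B$ of vector spaces. A bimodule over $M\xrightarrow{R}A$ is a tuple $(N\xrightarrow{S}B,l,r)$ in which $N\xrightarrow{S}B$ is a $2$-term chain complex with $B$ and $N$ both $A$-bimodules, and $l:M\otimes B\to N$, $r:B\otimes M\to N$ are bilinear maps such that for all $a\in A,b\in B,m\in M,n\in N$: - $l(a\cdot_M m,b)=a\cdot_N l(m,b)$, $l(m\cdot_M a,b)=l(m,a\cdot_B b)$, $l(m,b\cdot_B a)=l(m,b)\cdot_N a$; - $r(a\cdot_B b,m)=a\cdot_N r(b,m)$, $r(b\cdot_B a,m)=r(b,a\cdot_M m)$, $r(b,m\cdot_M a)=r(b,m)\cdot_N a$; - $R(m)\cdot_B S(n)=S(R(m)\cdot_N n+l(m,S(n)))$, $S(n)\cdot_B R(m)=S(r(S(n),m)+n\cdot_N R(m))$. **Cohomology.** $\mathcal{A}^{k-1,1}$ denotes the direct sum of all $k$-fold tensor products of $A$'s and $M$'s in which $A$ appears $k-1$ times and $M$ exactly once. Put $C^0_{\mathsf{rRB}}=0$, $C^1_{\mathsf{rRB}}=\mathrm{Hom}(A,B)\oplus\mathrm{Hom}(M,N)$, and for $k\ge2$, $C^k_{\mathsf{rRB}}=\mathrm{Hom}(A^{\otimes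 k},B)\oplus\mathrm{Hom}(\mathcal{A}^{k-1,1},N)\oplus\mathrm{Hom}(M^{\otimes k-1},B)$. The differential is $\delta_{\mathsf{rRB}}(\alpha,\beta)=(\delta_{A,B}(\alpha),\delta^\alpha_{A,N}(\beta),h_R(\alpha,\beta))$ for $k=1$ and $\delta_{\mathsf{rRB}}(\alpha,\beta,\gamma)=(\delta_{A,B}(\alpha),\delta^\alpha_{A,N}(\beta),\delta_{M,B}(\gamma)+h_R(\alpha,\beta))$ for $k\ge2$, where: - $\delta_{A,B}$ is the Hochschild coboundary of $A$ with coefficients in $B$: $(\delta_{A,B}f)(a_1,\dots,a_{k+1})=a_1\cdot_B f(a_2,\dots,a_{k+1})+\sum_{i=1}^k(-1)^i f(a_1,\dots,a_i\cdot a_{i+1},\dots,a_{k+1})+(-1)^{k+1}f(a_1,\dots,a_k)\cdot_B a_{k+1}$; - for $\alpha\in\mathrm{Hom}(A^{\otimes k},B)$, $\beta\in\mathrm{Hom}(\mathcal{A}^{k-1,1},N)$ and $a_1,\dots,a_{k+1}$ with exactly one entry $a_s\in M$ and the others in $A$, $\delta^\alpha_{A,N}(\beta)(a_1,\dots,a_{k+1})=(l+l_N)(a_1,(\alpha+\beta)(a_2,\dots,a_{k+1}))+\sum_{i=1}^k(-1)^i\beta(a_1,\dots,(\mu+l_M+r_M)(a_i,a_{i+1}),\dots,a_{k+1})+(-1)^{k+1}(r+r_N)((\alpha+\beta)(a_1,\dots,a_k),a_{k+1})$, where in each sum of maps one uses the one that is defined on the given arguments (e.g. the first term is $l(a_1,\alpha(a_2,\dots,a_{k+1}))$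 if $a_1\in M$ and $a_1\cdot_N\beta(a_2,\dots,a_{k+1})$ if $a_1\in A$; the last is $(-1)^{k+1}r(\alpha(a_1,\dots,a_k),a_{k+1})$ if $a_{k+1}\in M$ and $(-1)^{k+1}\beta(a_1,\dots,a_k)\cdot_N a_{k+1}$ if $a_{k+1}\in A$); - $\delta_{M,B}:\mathrm{Hom}(M^{\otimes k-1},B)\to\mathrm{Hom}(M^{\otimes k},B)$, $k\ge2$, is the Hochschild coboundary of the associative algebra $M_{\mathrm{Tot}}=(M,\ast_R)$, $m\ast_R m'=R(m)\cdot_M m'+m\cdot_M R(m')$, with coefficients in the $M_{\mathrm{Tot}}$-bimodule $B$ with actions $m\triangleright_B b=R(m)\cdot_B b-S(l(m,b))$, $b\triangleleft_B m=b\cdot_B R(m)-S(r(b,m))$; explicitly, $(\delta_{M,B}\gamma)(m_1,\dots,m_k)=m_1\triangleright_B\gamma(m_2,\dots,m_k)+\sum_{i=1}^{k-1}(-1)^i\gamma(m_1,\dots,m_i\ast_R m_{i+1},\dots,m_k)+(-1)^k\gamma(m_1,\dots,m_{k-1})\triangleleft_B m_k$; - $h_R(\alpha,\beta)(m_1,\dots,m_k)=(-1)^k\{\alpha(R(m_1),\dots,R(m_k))-\sum_{i=1}^k S\circ\beta(R(m_1),\dots,m_i,\dots,R(m_k))\}$. One has $\delta_{\mathsf{rRB}}^2=0$; $H^k_{\mathsf{rRB}}(M\xrightarrow{R}A;N\xrightarrow{S}B)$ is the $k$-th cohomology (cocycles modulo coboundaries). **Abelian extensions.** A $2$-term complex $N\xrightarrow{S}B$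 is regarded as a relative Rota-Baxter algebra with zero multiplication on $B$ and zero $B$-actions on $N$. An abelian extension of $M\xrightarrow{R}A$ by $N\xrightarrow{S}B$ is a relative Rota-Baxter algebra $\widehat M\xrightarrow{\widehat R}\widehat A$ together with morphisms of relative Rota-Baxter algebras $(i,\overline{i})$ from $N\xrightarrow{S}B$ to $\widehat M\xrightarrow{\widehat R}\widehat A$ and $(p,\overline{p})$ from $\widehat M\xrightarrow{\widehat R}\widehat A$ to $M\xrightarrow{R}A$ such that $0\to B\xrightarrow{i}\widehat A\xrightarrow{p}A\to0$ and $0\to N\xrightarrow{\overline{i}}\widehat M\xrightarrow{\overline{p}}M\to0$ are exact. A section is a pair of linear maps $s:A\to\widehat A$, $\overline{s}:M\to\widehat M$ with $p\circ s=\mathrm{id}_A$, $\overline{p}\circ\overline{s}=\mathrm{id}_M$. Identifying $B$ and $N$ with their images under $i,\overline{i}$, the induced bimodule structure on $N\xrightarrow{S}B$ is $a\cdot_B b=s(a)\cdot_{\widehat A}i(b)$, $b\cdot_B a=i(b)\cdot_{\widehat A}s(a)$, $a\cdot_N n=s(a)\cdot_{\widehat M}\overline{i}(n)$, $n\cdot_N a=\overline{i}(n)\cdot_{\widehat M}s(a)$, $l(m,b)=\overline{s}(m)\cdot_{\widehat M}i(b)$, $r(b,m)=i(b)\cdot_{\widehat M}\overline{s}(m)$; it is independent of the section. Two abelian extensions $\widehat M\xrightarrow{\widehat R}\widehat A$ and $\widehat M'\xrightarrow{\widehat R'}\widehat A'$ are isomorphic if there is an isomorphism $(\phi,\psi)$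 of relative Rota-Baxter algebras between them with $\phi\circ i=i'$, $\psi\circ\overline{i}=\overline{i}'$, $p'\circ\phi=p$, $\overline{p}'\circ\psi=\overline{p}$. *)

(* Defs.v *)
From HB Require Import structures.
From mathcomp Require Import all_boot all_algebra.
(* for the pointwise lmodType structure on function types *)
From mathcomp Require Import functions.

Set Implicit Arguments.
Unset Strict Implicit.
Unset Printing Implicit Defensive.

Import GRing.Theory.
Local Open Scope ring_scope.

(* Associative algebras, not necessarily unital (hence not MathComp's
   lalgType/algType). *)
Record assocAlg (k : fieldType) := AssocAlg {
  alg_sort :> lmodType k;
  amul : {bilinear alg_sort -> alg_sort -> alg_sort};
  amulA : forall a b c, amul (amul a b) c = amul a (amul b c)
}.
Arguments amul {_ _}.

Record bimodule (k : fieldType) (A : assocAlg k) := Bimodule {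
  bim_sort :> lmodType k;
  lact : {bilinear A -> bim_sort -> bim_sort};
  ract : {bilinear bim_sort -> A -> bim_sort};
  lact_mul : forall a a' m, lact (amul a a') m = lact a (lact a' m);
  lact_ract : forall a m a', ract (lact a m) a' = lact a (ract m a');
  ract_mul : forall m a a', ract (ract m a) a' = ract m (amul a a')
}.
Arguments lact {_ _ _}.
Arguments ract {_ _ _}.

Record rRBAlg (k : fieldType) := RRBAlg {
  rb_alg : assocAlg k;
  rb_mod : bimodule rb_alg;
  rb_op : {linear rb_mod -> rb_alg};
  rb_opP : forall m m' : rb_mod,
    amul (rb_op m) (rb_op m')
    = rb_op (lact (rb_op m) m' + ract m (rb_op m'))
}.

Record rRBMorph (k : fieldType) (X Y : rRBAlg k) := RRBMorph {
  mor_alg : {linear rb_alg X -> rb_alg Y};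
  mor_mod : {linear rb_mod X -> rb_mod Y};
  mor_mul : forall a a', mor_alg (amul a a') = amul (mor_alg a) (mor_alg a');
  mor_lact : forall a m, mor_mod (lact a m) = lact (mor_alg a) (mor_mod m);
  mor_ract : forall m a, mor_mod (ract m a) = ract (mor_mod m) (mor_alg a);
  mor_op : forall m, mor_alg (rb_op X m) = rb_op Y (mor_mod m)
}.

Definition rRBMorph_iso (k : fieldType) (X Y : rRBAlg k) (f : rRBMorph X Y) :
    Prop :=
  bijective (mor_alg f) /\ bijective (mor_mod f).

(* A bimodule (N --S--> B, l, r) over the relative Rota-Baxter algebra
   X = (M --R--> A). *)
Record rRBBimod (k : fieldType) (X : rRBAlg k) := RRBBimod {
  cB : bimodule (rb_alg X);
  cN : bimodule (rb_alg X);
  cS : {linear cN -> cB};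
  cl : {bilinear rb_mod X -> cB -> cN};
  cr : {bilinear cB -> rb_mod X -> cN};
  cl_lact : forall a m b, cl (lact a m) b = lact a (cl m b);
  cl_ract : forall m a b, cl (ract m a) b = cl m (lact a b);
  cl_bract : forall m b a, cl m (ract b a) = ract (cl m b) a;
  cr_blact : forall a b m, cr (lact a b) m = lact a (cr b m);
  cr_lact : forall b a m, cr (ract b a) m = cr b (lact a m);
  cr_ract : forall b m a, cr b (ract m a) = ract (cr b m) a;
  cS_lact : forall m n,
    lact (rb_op X m) (cS n) = cS (lact (rb_op X m) n + cl m (cS n));
  cS_ract : forall n m,
    ract (cS n) (rb_op X m) = cS (cr (cS n) m + ract n (rb_op X m))
}.

(* The relative Rota-Baxter algebra N --S--> B with zero multiplication on B
   and zero actions of B on N. *)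
Section ZeroStructure.
Variable k : fieldType.

Definition bizero (U V W : lmodType k) (u : U) (v : V) : W := 0.

Lemma bizero_bilinear (U V W : lmodType k) :
  bilinear_for (GRing.Scale.Law.clone _ _ *:%R _)
    (GRing.Scale.Law.clone _ _ *:%R _) (@bizero U V W).
Proof. by split=> ? ? ? ?; rewrite /bizero /= scaler0 addr0. Qed.

HB.instance Definition _ (U V W : lmodType k) :=
  bilinear_isBilinear.Build k U V W *:%R *:%R (@bizero U V W)
    (bizero_bilinear U V W).

Variables (N B : lmodType k) (S : {linear N -> B}).

Definition zeroAlg : assocAlg k :=
  @AssocAlg k B (@bizero B B B) (fun _ _ _ => erefl).

Definition zeroBimod : bimodule zeroAlg :=
  @Bimodule k zeroAlg N (@bizero B N N) (@bizero N B N)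
    (fun _ _ _ => erefl) (fun _ _ _ => erefl) (fun _ _ _ => erefl).

Fact zeroRRB_subproof (n n' : zeroBimod) :
  @amul k zeroAlg (S n) (S n')
  = S (@lact k zeroAlg zeroBimod (S n) n' + @ract k zeroAlg zeroBimod n (S n')).
Proof. by rewrite /= /bizero addr0 linear0. Qed.

Definition zeroRRB : rRBAlg k := @RRBAlg k zeroAlg zeroBimod S zeroRRB_subproof.

End ZeroStructure.

Section Cochains.
Variable k : fieldType.

(* A word of length n in a type T is a function 'I_n -> T (positions counted
   from 0); Hom(V^{(x) n}, W) is the space of multilinear maps on words. *)

Definition behead_word T n (x : 'I_n.+1 -> T) : 'I_n -> T :=
  fun i => x (lift ord0 i).

Definition belast_word T n (x : 'I_n.+1 -> T) : 'I_n -> T :=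
  fun i => x (widen_ord (leqnSn n) i).

(* (x_0, .., op x_i x_(i+1), .., x_n) *)
Definition contract_word T (op : T -> T -> T) n (i : 'I_n)
    (x : 'I_n.+1 -> T) : 'I_n -> T :=
  fun j => if (j < i)%N then belast_word x j
           else if j == i then op (belast_word x i) (behead_word x i)
           else behead_word x j.

Definition multilinear (V W : lmodType k) n (f : ('I_n -> V) -> W) : Prop :=
  forall (x : 'I_n -> V) (i : 'I_n), linear (fun v => f [eta x with i |-> v]).

(* The Hochschild coboundary for a product mul on V and actions la, ra of V
   on W; positions being counted from 0, the sign of the i-th contraction is
   (-1)^(i+1). *)
Definition hochschild (V W : lmodType k) (mul : V -> V -> V)
    (la : V -> W -> W) (ra : W -> V -> W) n (f : ('I_n -> V) -> W) :
    ('I_n.+1 -> V) -> W :=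
  fun x => la (x ord0) (f (behead_word x))
    + \sum_(i < n) (-1) ^+ i.+1 *: f (contract_word mul i x)
    + (-1) ^+ n.+1 *: ra (f (belast_word x)) (x ord_max).

Variables (X : rRBAlg k) (Y : rRBBimod X).
Local Notation A := (rb_alg X).
Local Notation M := (rb_mod X).
Local Notation R := (rb_op X).
Local Notation B := (cB Y).
Local Notation N := (cN Y).
Local Notation S := (cS Y).

(* Words in A + M. An element of Hom(A^{n-1,1}, N) is encoded as a function on
   all words of length n which is linear in each letter (for each of the two
   types of letter), and which vanishes on the irrelevant words, i.e. those
   which do not contain exactly one letter from M. *)

Definition in_mod (u : A + M) : bool := if u is inr _ then true else false.

Definition num_mod n (x : 'I_n -> A + M) : nat := #|[pred i | in_mod (x i)]|.

Definition mixed_multilinear n (f : ('I_n -> A + M) -> N) : Prop :=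
  [/\ forall x, num_mod x != 1%N -> f x = 0,
      forall (x : 'I_n -> A + M) (i : 'I_n),
        linear (fun a : A => f [eta x with i |-> inl a])
    & forall (x : 'I_n -> A + M) (i : 'I_n),
        linear (fun m : M => f [eta x with i |-> inr m])].

(* mu + l_M + r_M; two letters from M never meet below. *)
Definition mixed_mul (u v : A + M) : A + M :=
  match u, v with
  | inl a, inl a' => inl (amul a a')
  | inl a, inr m => inr (lact a m)
  | inr m, inl a => inr (ract m a)
  | inr _, inr _ => inr 0
  end.

Definition alg_part (u : A + M) : A := if u is inl a then a else 0.

(* alpha + beta, applied to words with at most one letter from M. *)
Definition mixed_sum n (alpha : ('I_n -> A) -> B) (beta : ('I_n -> A + M) -> N)
    (x : 'I_n -> A + M) : B + N :=
  if num_mod x == 0%N then inl (alpha (fun i => alg_part (x i)))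
  else inr (beta x).

(* l + l_N and r + r_N; the remaining combinations of arguments do not occur
   on words with exactly one letter from M. *)
Definition mixed_lact (u : A + M) (v : B + N) : N :=
  match u, v with
  | inl a, inr n => lact a n
  | inr m, inl b => cl Y m b
  | _, _ => 0
  end.

Definition mixed_ract (v : B + N) (u : A + M) : N :=
  match v, u with
  | inr n, inl a => ract n a
  | inl b, inr m => cr Y b m
  | _, _ => 0
  end.

Definition delta_AB n (alpha : ('I_n -> A) -> B) : ('I_n.+1 -> A) -> B :=
  hochschild (@amul k A) (@lact k A B) (@ract k A B) alpha.

Definition delta_AN n (alpha : ('I_n -> A) -> B)
    (beta : ('I_n -> A + M) -> N) : ('I_n.+1 -> A + M) -> N :=
  fun x => if num_mod x == 1%N then
      mixed_lact (x ord0) (mixed_sum alpha beta (behead_word x))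
      + \sum_(i < n) (-1) ^+ i.+1 *: beta (contract_word mixed_mul i x)
      + (-1) ^+ n.+1 *:
          mixed_ract (mixed_sum alpha beta (belast_word x)) (x ord_max)
    else 0.

Definition tot_mul (m m' : M) : M := lact (R m) m' + ract m (R m').
Definition tot_lact (m : M) (b : B) : B := lact (R m) b - S (cl Y m b).
Definition tot_ract (b : B) (m : M) : B := ract b (R m) - S (cr Y b m).

Definition delta_MB n (gamma : ('I_n -> M) -> B) : ('I_n.+1 -> M) -> B :=
  hochschild tot_mul tot_lact tot_ract gamma.

Definition h_R n (alpha : ('I_n -> A) -> B) (beta : ('I_n -> A + M) -> N) :
    ('I_n -> M) -> B :=
  fun m => (-1) ^+ n *:
    (alpha (fun j => R (m j))
     - \sum_(i < n) S (beta (fun j => if j == i then inr (m j)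
                                      else inl (R (m j))))).

(* Ambient vector spaces of the cochain complex, without the multilinearity
   conditions; the cochains are singled out by [is_cochain]. *)
Definition precochain (n : nat) : lmodType k :=
  match n with
  | 0 => 'rV[k]_0
  | 1 => ((('I_1 -> A) -> B) * (('I_1 -> A + M) -> N))%type
  | p.+1 as n => ((('I_n -> A) -> B) * (('I_n -> A + M) -> N)
                  * (('I_p -> M) -> B))%type
  end.

Definition is_cochain (n : nat) : precochain n -> Prop :=
  match n with
  | 0 => fun _ => True
  | 1 => fun c => multilinear c.1 /\ mixed_multilinear c.2
  | _.+2 => fun c => [/\ multilinear c.1.1, mixed_multilinear c.1.2
                       & multilinear c.2]
  end.

Definition delta_rRB (n : nat) : precochain n -> precochain n.+1 :=
  match n with
  | 0 => fun _ => 0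
  | 1 => fun c => (delta_AB c.1, delta_AN c.1 c.2, h_R c.1 c.2)
  | _.+2 => fun c => (delta_AB c.1.1, delta_AN c.1.1 c.1.2,
                      delta_MB c.2 + h_R c.1.1 c.1.2)
  end.

Definition cocycle n (c : precochain n) : Prop :=
  is_cochain c /\ delta_rRB c = 0.

Definition coboundary n : precochain n -> Prop :=
  match n with
  | 0 => fun c => c = 0
  | _.+1 => fun c => exists2 b, is_cochain b & c = delta_rRB b
  end.

(* Cocycles modulo coboundaries: the set of cosets z + B^n, z in Z^n. *)
Definition cohomology (n : nat) : Type :=
  {K : precochain n -> Prop |
    exists2 z, cocycle z & K = (fun z' => coboundary (z' - z))}.

End Cochains.

Section Extensions.
Variable k : fieldType.

(* 0 -> U -f-> V -g-> W -> 0 is exact. *)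
Definition short_exact (U V W : lmodType k) (f : U -> V) (g : V -> W) : Prop :=
  [/\ injective f,
      forall v, g v = 0 <-> exists u, f u = v
    & forall w, exists v, g v = w].

Record abExt (X : rRBAlg k) (N B : lmodType k) (S : {linear N -> B}) := AbExt {
  ext_tot : rRBAlg k;
  ext_i : rRBMorph (zeroRRB S) ext_tot;
  ext_p : rRBMorph ext_tot X;
  ext_exact_alg : short_exact (mor_alg ext_i) (mor_alg ext_p);
  ext_exact_mod : short_exact (mor_mod ext_i) (mor_mod ext_p)
}.

Definition abExt_iso X (N B : lmodType k) (S : {linear N -> B})
    (E E' : abExt X S) : Prop :=
  exists f : rRBMorph (ext_tot E) (ext_tot E'),
    [/\ rRBMorph_iso f,
        forall b, mor_alg f (mor_alg (ext_i E) b) = mor_alg (ext_i E') b,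
        forall n, mor_mod f (mor_mod (ext_i E) n) = mor_mod (ext_i E') n,
        forall a, mor_alg (ext_p E') (mor_alg f a) = mor_alg (ext_p E) a
      & forall m, mor_mod (ext_p E') (mor_mod f m) = mor_mod (ext_p E) m].

Variables (X : rRBAlg k) (Y : rRBBimod X).
Local Notation A := (rb_alg X).
Local Notation M := (rb_mod X).

Definition is_section (E : abExt X (cS Y)) (s : {linear A -> rb_alg (ext_tot E)})
    (sbar : {linear M -> rb_mod (ext_tot E)}) : Prop :=
  (forall a, mor_alg (ext_p E) (s a) = a) /\
  (forall m, mor_mod (ext_p E) (sbar m) = m).

(* The bimodule structure induced by the extension E on N --S--> B is the one
   of Y. Equalities are stated in the extension, after embedding B and N by
   (i, ibar). The induced structure does not depend on the section, and
   sections exist since k is a field. *)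
Definition induces (E : abExt X (cS Y)) : Prop :=
  forall (s : {linear A -> rb_alg (ext_tot E)})
         (sbar : {linear M -> rb_mod (ext_tot E)}), is_section s sbar ->
  let i := mor_alg (ext_i E) in
  let ibar := mor_mod (ext_i E) in
  [/\ forall (a : A) (b : cB Y), i (lact a b) = amul (s a) (i b),
      forall (b : cB Y) (a : A), i (ract b a) = amul (i b) (s a),
      forall (a : A) (n : cN Y), ibar (lact a n) = lact (s a) (ibar n)
    & forall (n : cN Y) (a : A), ibar (ract n a) = ract (ibar n) (s a)] /\
  (forall (m : M) (b : cB Y), ibar (cl Y m b) = ract (sbar m) (i b)) /\
  (forall (b : cB Y) (m : M), ibar (cr Y b m) = lact (i b) (sbar m)).

(* Ext(X; Y): the set of isomorphism classes of abelian extensions of X by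
   N --S--> B which induce the bimodule structure of Y. *)
Definition Ext : Type :=
  {K : abExt X (cS Y) -> Prop |
    exists2 E, induces E & K = abExt_iso E}.

End Extensions.

(* Main.v *)
(* Choose linear sections s, sb of an extension. Their failure to respect the
   products, the actions and the Rota-Baxter operator takes values in B and N,
   and is recorded by a 2-cochain (al, bl + br, ga), the factor set:
     s a * s a' - s (a a'),     s a . sb m - sb (a . m),
     sb m . s a - sb (m . a),   Rh (sb m) - s (R m).
   The axioms of a relative Rota-Baxter algebra say that it is a cocycle, and
   conversely a cocycle twists the structure of (M + N -> A + B) into an
   extension with this factor set. An extension with a section is isomorphic to
   the twisted one through (a, b) |-> s a + i b. The sections of a given
   extension form a torsor under the 1-cochains (phi, psi), and changing the
   section adds delta (phi, psi) to the factor set; hence the factor sets of an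
   extension form exactly one class modulo coboundaries. *)
Require Import Defs.
From mathcomp Require Import all_boot all_algebra.
From HB Require Import structures.
From mathcomp Require Import boolp functions classical_sets.
Local Open Scope ring_scope.

Set Implicit Arguments.
Unset Strict Implicit.
Unset Printing Implicit Defensive.

Import GRing.Theory.

(** * Bijections and linear maps from their defining properties *)

Lemma inj_surj_bijective (T U : Type) (f : T -> U) :
  injective f -> (forall u, exists t, f t = u) -> bijective f.
Proof.
move=> f_inj f_surj; pose g u := sval (cid (f_surj u)).
have fK : cancel g f by move=> u; exact: (svalP (cid (f_surj u))).
by exists g => // t; apply: f_inj; rewrite fK.
Qed.

Definition linear_pack (k : fieldType) (V W : lmodType k) (f : V -> W)
    (f_lin : linear f) : {linear V -> W} :=
  HB.pack f (GRing.isLinear.Build k V W *:%R f f_lin).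

Definition bilinear_pack (k : fieldType) (U V W : lmodType k)
    (f : U -> V -> W) (f_linl : forall v, linear (f^~ v))
    (f_linr : forall u, linear (f u)) : {bilinear U -> V -> W} :=
  HB.pack f
    (bilinear_isBilinear.Build k U V W *:%R *:%R f (f_linl, f_linr)).

(** * Linear sections *)

Section Splitting.
Variables (k : fieldType) (V W : lmodType k) (g : {linear V -> W}).
Local Open Scope classical_set_scope.

Let independent (C : set V) :=
  (forall a x y, C x -> C y -> C (a *: x + y)) /\
  (forall x, C x -> g x = 0 -> x = 0).

(** Zorn's lemma gives a maximal independent [C]. If [g v] were not reached from [C], then the span
    of [v] and [C] would be a larger independent set. *)
Lemma kernel_complement :
  exists C : set V, [/\ C 0, forall a x y, C x -> C y -> C (a *: x + y),
    forall x, C x -> g x = 0 -> x = 0 &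
    forall v, exists2 c, C c & g c = g v].
Proof.
have [F FP Ftot|C [[Clin Ck] Cmax]] := @Zorn_bigcup V independent.
  split=> [a x y [C1 F1 C1x] [C2 F2 C2y]|x [C FC Cx]].
    by have [C12|C21] := Ftot _ _ F1 F2;
      [exists C2|exists C1] => //; apply: (FP _ _).1 => //; auto.
  exact: (FP _ FC).2.
(* A maximal [C] without 0 is empty, as [- x + x] lies in [C] with [x]; but then the set reduced to
   0 is larger. *)
have C0 : C 0.
  apply: contrapT => nC0.
  have Cempty x : ~ C x.
    by move=> Cx; apply: nC0; rewrite -(addNr x) -scaleN1r; exact: Clin.
  apply: (Cmax [set 0]).
    by split=> [x /Cempty//|/(_ 0 erefl)].
  by split=> [a x y -> ->|x ->//]; rewrite scaler0 addr0.
exists C; split=> // v; apply: contrapT => nv.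
pose D := [set x | exists a c, C c /\ x = a *: v + c].
apply: (Cmax D).
  split=> [x Cx|DC]; first by exists 0, x; rewrite scale0r add0r.
  apply: nv; exists v => //; apply: DC; exists 1, 0.
  by rewrite scale1r addr0.
split=> [a x y [b [c [Cc ->]]] [b' [c' [Cc' ->]]]|x [a [c [Cc ->]]]].
  exists (a * b + b'), (a *: c + c'); split; first exact: Clin.
  by rewrite scalerDr scalerA scalerDl addrACA.
(* For [a] nonzero, [g (a *: v + c) = 0] would make [- a^-1 *: c] an element of [C] with the same
   image as [v]. *)
have [->|a0] := eqVneq a 0; first by rewrite scale0r add0r => /Ck ->.
rewrite linearD linearZ /= => gac; case: nv.
exists ((- a^-1) *: c).
  by have := Clin (- a^-1) c 0 Cc C0; rewrite addr0.
rewrite linearZ /= -[g c](addKr (a *: g v)) gac addr0 scalerN scaleNr opprK.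
by rewrite scalerA mulVf // scale1r.
Qed.

(** Preimages chosen inside the complement are unique, and this forces linearity: the defect
    [a *: s x + s y - s (a *: x + y)] lies both in [C] and in the kernel. *)
Lemma linear_section :
  (forall w, exists v, g v = w) -> exists s : {linear W -> V}, cancel s g.
Proof.
move=> gsurj; have [C [C0 Clin Ck Csurj]] := kernel_complement.
have sP w : exists v, C v /\ g v = w.
  by have [v <-] := gsurj w; have [c] := Csurj v; exists c.
pose s w := sval (cid (sP w)).
have sC w : C (s w) by exact: (svalP (cid (sP w))).1.
have sK w : g (s w) = w by exact: (svalP (cid (sP w))).2.
have s_lin : linear s.
  move=> a x y; apply: subr0_eq; apply: Ck.
    have := Clin (-1) _ _ (Clin a _ _ (sC x) (sC y)) (sC (a *: x + y)).
    by rewrite scaleN1r [X in C X]addrC.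
  by rewrite linearB linearP /= !sK subrr.
by exists (linear_pack s_lin).
Qed.

End Splitting.

(** * Identities in abelian groups *)

(** Syntax for a proof by reflection; variables are indices into a list of atoms. *)
Inductive zexpr := ZVar of nat | ZAdd of zexpr & zexpr | ZOpp of zexpr | ZZero.

Fixpoint zcoef (e : zexpr) (i : nat) : int :=
  match e with
  | ZVar j => (i == j)%:Z
  | ZAdd e1 e2 => zcoef e1 i + zcoef e2 i
  | ZOpp e => - zcoef e i
  | ZZero => 0
  end.

Fixpoint zbound (e : zexpr) : nat :=
  match e with
  | ZVar j => j.+1
  | ZAdd e1 e2 => maxn (zbound e1) (zbound e2)
  | ZOpp e => zbound e
  | ZZero => 0%N
  end.

Section Zeval.
Variables (V : zmodType) (env : seq V).

Fixpoint zeval (e : zexpr) : V :=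
  match e with
  | ZVar j => env`_j
  | ZAdd e1 e2 => zeval e1 + zeval e2
  | ZOpp e => - zeval e
  | ZZero => 0
  end.

Lemma zevalE e n : (zbound e <= n)%N ->
  zeval e = \sum_(i < n) env`_i *~ zcoef e i.
Proof.
elim: e => [j|e1 IH1 e2 IH2|e IH|] /= le_n.
- rewrite (bigD1 (Ordinal le_n)) //= eqxx mulr1z big1 ?addr0 // => i ne_ij.
  by rewrite -[(i == j :> nat)]/(i == Ordinal le_n) (negPf ne_ij) mulr0z.
- rewrite IH1 ?IH2 ?(leq_trans _ le_n) ?leq_maxl ?leq_maxr // -big_split /=.
  by apply: eq_bigr => i _; rewrite mulrzDr.
- by rewrite IH // -sumrN; apply: eq_bigr => i _; rewrite mulrNz.
- by rewrite big1 // => i _; rewrite mulr0z.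
Qed.

(** Both sides normalise to integer combinations of the first [n] atoms, so a computation on
    coefficients settles the equality. *)
Lemma zeval_eq e1 e2 (n := maxn (zbound e1) (zbound e2)) :
  all (fun i => zcoef e1 i == zcoef e2 i) (iota 0 n) -> zeval e1 = zeval e2.
Proof.
move=> /allP eq12; rewrite !(@zevalE _ n) ?leq_maxl ?leq_maxr //.
by apply: eq_bigr => i _; rewrite (eqP (eq12 i _)) // mem_iota /=.
Qed.

End Zeval.

(* Atoms are compared up to conversion: the same scalar multiplication can be
   reached along several inheritance paths. *)
Ltac zfind x env :=
  match env with
  | ?y :: _ => let _ := match goal with _ => unify x y end in constr:(0%N)
  | _ :: ?env' => let n := zfind x env' in constr:(S n)
  end.

Ltac zenv x env :=
  lazymatch x with
  | ?a + ?b => let env1 := zenv a env in zenv b env1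
  | - ?a => zenv a env
  | 0 => env
  | _ => match env with
         | _ => let n := zfind x env in env
         | _ => constr:(x :: env)
         end
  end.

Ltac zreify x env :=
  lazymatch x with
  | ?a + ?b => let e1 := zreify a env in let e2 := zreify b env in
               constr:(ZAdd e1 e2)
  | - ?a => let e := zreify a env in constr:(ZOpp e)
  | 0 => constr:(ZZero)
  | _ => let n := zfind x env in constr:(ZVar n)
  end.

(* Decides identities between sums and opposites in a zmodType, comparing the
   integer coefficients of the atoms. *)
Ltac zmodule :=
  lazymatch goal with
  | |- ?l = ?r :> ?T =>
    let env0 := constr:(@nil T) in
    let env1 := zenv l env0 in
    let env := zenv r env1 in
    let e1 := zreify l env in
    let e2 := zreify r env in
    refine (@zeval_eq _ env e1 e2 _); vm_compute; reflexivity
  end.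

(** * Cochains of low degree *)

Definition word1 T (x : T) : 'I_1 -> T := fun=> x.

Definition word2 T (x y : T) : 'I_2 -> T :=
  fun i => if val i is 0%N then x else y.

Definition word3 T (x y z : T) : 'I_3 -> T :=
  fun i => match val i with 0 => x | 1 => y | _ => z end%N.

(** * Words of length at most three and their contractions *)

Section Words.
Variable T : Type.
Implicit Types x y z : T.

Lemma word1E (w : 'I_1 -> T) : w = word1 (w ord0).
Proof. by apply/funext => i; rewrite ord1. Qed.

Lemma word2E (w : 'I_2 -> T) : w = word2 (w ord0) (w ord_max).
Proof.
by apply/funext=> -[[|[|//]] lt_i2]; rewrite /word2 /=; congr w; exact: val_inj.
Qed.

Lemma word3E (w : 'I_3 -> T) :
  w = word3 (w ord0) (w (lift ord0 ord0)) (w ord_max).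
Proof.
by apply/funext=> -[[|[|[|//]]] lt_i3]; rewrite /word3 /=; congr w;
  exact: val_inj.
Qed.

Lemma behead_word2 x y : behead_word (word2 x y) = word1 y.
Proof. exact/funext. Qed.

Lemma belast_word2 x y : belast_word (word2 x y) = word1 x.
Proof. by apply/funext => i; rewrite ord1. Qed.

Lemma behead_word3 x y z : behead_word (word3 x y z) = word2 y z.
Proof. by apply/funext=> -[[|[|//]] lt_i2]. Qed.

Lemma belast_word3 x y z : belast_word (word3 x y z) = word2 x y.
Proof. by apply/funext=> -[[|[|//]] lt_i2]. Qed.

Lemma subst_word2_0 x y t :
  ([eta word2 x y with ord0 |-> t] : 'I_2 -> T) = word2 t y.
Proof. by apply/funext=> -[[|[|//]] lt_i2]. Qed.

Lemma subst_word2_1 x y t :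
  ([eta word2 x y with ord_max |-> t] : 'I_2 -> T) = word2 x t.
Proof. by apply/funext=> -[[|[|//]] lt_i2]. Qed.

Variables (k : fieldType) (W : lmodType k) (op : T -> T -> T).

Lemma sum_contract_word2 (f : ('I_1 -> T) -> W) x y :
  \sum_(i < 1) (-1) ^+ i.+1 *: f (contract_word op i (word2 x y))
  = - f (word1 (op x y)).
Proof.
rewrite big_ord1 expr1 scaleN1r; congr (- f _).
by apply/funext=> -[[|//] lt_j1].
Qed.

Lemma sum_contract_word3 (f : ('I_2 -> T) -> W) x y z :
  \sum_(i < 2) (-1) ^+ i.+1 *: f (contract_word op i (word3 x y z))
  = - f (word2 (op x y) z) + f (word2 x (op y z)).
Proof.
rewrite !big_ord_recl big_ord0 addr0 expr1 sqrrN expr1n scaleN1r scale1r.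
by congr (- f _ + f _); apply/funext=> -[[|[|//]] lt_i2].
Qed.

End Words.

Lemma ord2_cases (i : 'I_2) : i = ord0 \/ i = ord_max.
Proof. by case: i => -[|[|//]] lt_i2; [left|right]; exact: val_inj. Qed.

(** * Hochschild coboundary and multilinearity in low degree *)

Section Hochschild.
Variables (k : fieldType) (V W : lmodType k) (mul : V -> V -> V).
Variables (la : V -> W -> W) (ra : W -> V -> W).

Lemma hochschild1E (f : ('I_1 -> V) -> W) x y :
  hochschild mul la ra f (word2 x y)
  = la x (f (word1 y)) - f (word1 (mul x y)) + ra (f (word1 x)) y.
Proof.
rewrite /hochschild sum_contract_word2 behead_word2 belast_word2.
by rewrite sqrrN expr1n scale1r.
Qed.

Lemma hochschild2E (f : ('I_2 -> V) -> W) x y z :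
  hochschild mul la ra f (word3 x y z)
  = la x (f (word2 y z)) - f (word2 (mul x y) z) + f (word2 x (mul y z))
    - ra (f (word2 x y)) z.
Proof.
rewrite /hochschild sum_contract_word3 behead_word3 belast_word3.
by rewrite -signr_odd /= expr1 scaleN1r addrA.
Qed.

Lemma multilinear1P (f : ('I_1 -> V) -> W) :
  multilinear f <-> linear (fun x => f (word1 x)).
Proof.
have sub (x : 'I_1 -> V) t : ([eta x with ord0 |-> t] : 'I_1 -> V) = word1 t.
  by apply/funext => j; rewrite (ord1 j).
split=> [f_lin a x y|f_lin x i a u v].
  by have := f_lin (word1 0) ord0 a x y; rewrite /= !sub.
by rewrite (ord1 i) /= !sub; exact: f_lin.
Qed.

Lemma multilinear2P (f : ('I_2 -> V) -> W) :
  multilinear f <-> (forall y, linear (fun x => f (word2 x y))) /\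
                    (forall x, linear (fun y => f (word2 x y))).
Proof.
split=> [f_lin|[linl linr] w i a u v].
  split=> z a x y.
    by have := f_lin (word2 0 z) ord0 a x y; rewrite /= !subst_word2_0.
  by have := f_lin (word2 z 0) ord_max a x y; rewrite /= !subst_word2_1.
rewrite /= (word2E w); case: (ord2_cases i) => ->.
  by rewrite !subst_word2_0; exact: linl.
by rewrite !subst_word2_1; exact: linr.
Qed.

End Hochschild.

(** * Cochains and cocycles in degrees one and two, in coordinates *)

Section LowDegree.
Variables (k : fieldType) (X : rRBAlg k) (Y : rRBBimod X).
Local Notation A := (rb_alg X).
Local Notation M := (rb_mod X).
Local Notation R := (rb_op X).
Local Notation B := (cB Y).
Local Notation N := (cN Y).
Local Notation S := (cS Y).

Lemma num_mod1 (u : A + M) : num_mod (word1 u) = in_mod u.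
Proof.
by rewrite /num_mod -sum1_card big_mkcond big_ord1 inE; case: in_mod.
Qed.

Lemma num_mod2 (u v : A + M) : num_mod (word2 u v) = (in_mod u + in_mod v)%N.
Proof.
rewrite /num_mod -sum1_card big_mkcond !big_ord_recl big_ord0 !inE /= addn0.
by do 2!case: in_mod.
Qed.

Lemma num_mod3 (u v w : A + M) :
  num_mod (word3 u v w) = (in_mod u + in_mod v + in_mod w)%N.
Proof.
rewrite /num_mod -sum1_card big_mkcond !big_ord_recl big_ord0 !inE /= addn0.
by do 3!case: in_mod.
Qed.

Definition cochain1 (phi : A -> B) (psi : M -> N) : precochain Y 1 :=
  (fun x => phi (x ord0), fun x => if x ord0 is inr m then psi m else 0).

Definition mixed2 (bl : A -> M -> N) (br : M -> A -> N) (u v : A + M) : N :=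
  match u, v with
  | inl a, inr m => bl a m
  | inr m, inl a => br m a
  | _, _ => 0
  end.

(** The mixed component splits according to the position of the letter from [M], and is 0 on the
    other words. Linearity is not built in, so that factor sets can be written this way before they
    are known to be bilinear. *)
Definition cochain2 (al : A -> A -> B) (bl : A -> M -> N) (br : M -> A -> N)
    (ga : M -> B) : precochain Y 2 :=
  (fun x => al (x ord0) (x ord_max),
   fun x => mixed2 bl br (x ord0) (x ord_max), fun x => ga (x ord0)).

Lemma is_cochain1P (c : precochain Y 1) :
  is_cochain c <->
  exists (phi : {linear A -> B}) (psi : {linear M -> N}), c = cochain1 phi psi.
Proof.
split=> [|[phi [psi ->]]].
  case: c => al be /= [/multilinear1P al_lin [be0 _ be_lin]].
  have psi_lin : linear (fun m : M => be (word1 (inr m))).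
    have sub (x : 'I_1 -> A + M) t :
        ([eta x with ord0 |-> t] : 'I_1 -> A + M) = word1 t.
      by apply/funext => j; rewrite (ord1 j).
    move=> a x y; have := be_lin (word1 (inr 0)) ord0 a x y.
    by rewrite /= !sub.
  exists (linear_pack al_lin), (linear_pack psi_lin).
  congr pair; apply/funext => x /=.
    by rewrite {1}(word1E x).
  case x0: (x ord0) => [a|m]; rewrite {1}(word1E x) x0 // be0 //.
  by rewrite num_mod1.
split; first by apply/multilinear1P => a u v; rewrite /= linearP.
split=> [x|x i a u v|x i a u v] /=; first last.
- by rewrite (ord1 i) /= linearP.
- by rewrite (ord1 i) /= scaler0 addr0.
- by rewrite {1}(word1E x) num_mod1; case: (x ord0).
Qed.

Lemma is_cochain2P (c : precochain Y 2) :
  is_cochain c <->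
  exists (al : {bilinear A -> A -> B}) (bl : {bilinear A -> M -> N})
    (br : {bilinear M -> A -> N}) (ga : {linear M -> B}),
    c = cochain2 al bl br ga.
Proof.
split.
  case: c => -[al be] ga.
  move=> /= [/multilinear2P[al_l al_r] [be0 be_a be_m] /multilinear1P ga_lin].
  have bl_l m : linear (fun a : A => be (word2 (inl a) (inr m))).
    move=> a x y; have := be_a (word2 (inl 0) (inr m)) ord0 a x y.
    by rewrite /= !subst_word2_0.
  have bl_r a : linear (fun m : M => be (word2 (inl a) (inr m))).
    move=> b x y; have := be_m (word2 (inl a) (inr 0)) ord_max b x y.
    by rewrite /= !subst_word2_1.
  have br_l a : linear (fun m : M => be (word2 (inr m) (inl a))).
    move=> b x y; have := be_m (word2 (inr 0) (inl a)) ord0 b x y.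
    by rewrite /= !subst_word2_0.
  have br_r m : linear (fun a : A => be (word2 (inr m) (inl a))).
    move=> a x y; have := be_a (word2 (inr m) (inl 0)) ord_max a x y.
    by rewrite /= !subst_word2_1.
  exists (bilinear_pack al_l al_r), (bilinear_pack bl_l bl_r).
  exists (bilinear_pack br_l br_r), (linear_pack ga_lin).
  congr (_, _, _); apply/funext => x /=.
  - by rewrite {1}(word2E x).
  - rewrite {1}(word2E x); case: (x ord0) (x ord_max) => [a|m] [a'|m'] //=;
      by rewrite be0 // num_mod2.
  - by rewrite {1}(word1E x).
move=> [al [bl [br [ga ->]]]]; split.
- by apply/multilinear2P; split=> z a x y; rewrite /= (linearPl, linearPr).
- split=> [x|x i b u v|x i b u v] /=.
  + by rewrite {1}(word2E x) num_mod2; case: (x ord0) (x ord_max) => ? [].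
  + case: (ord2_cases i) => -> /=.
      by case: (x ord_max) => ? /=; rewrite ?linearPl ?scaler0 ?addr0.
    by case: (x ord0) => ? /=; rewrite ?linearPr ?scaler0 ?addr0.
  + case: (ord2_cases i) => -> /=.
      by case: (x ord_max) => ? /=; rewrite ?linearPl ?scaler0 ?addr0.
    by case: (x ord0) => ? /=; rewrite ?linearPr ?scaler0 ?addr0.
- by apply/multilinear1P => a u v; rewrite /= linearP.
Qed.

Lemma cochain2D al bl br ga al' bl' br' ga' :
  cochain2 al bl br ga + cochain2 al' bl' br' ga' =
  cochain2 (fun a b => al a b + al' a b) (fun a m => bl a m + bl' a m)
    (fun m a => br m a + br' m a) (fun m => ga m + ga' m).
Proof.
congr (_, _, _); apply/funext => x //=.
by rewrite /GRing.add /=; case: (x ord0) (x ord_max) => [?|?] [?|?] /=;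
  rewrite ?addr0.
Qed.

Lemma cochain2_inj al bl br ga al' bl' br' ga' :
  cochain2 al bl br ga = cochain2 al' bl' br' ga' ->
  [/\ al =2 al', bl =2 bl', br =2 br' & ga =1 ga'].
Proof.
move=> [eq_al eq_be eq_ga]; split=> [a b|a m|m a|m].
- exact: (congr1 (@^~ (word2 a b)) eq_al).
- exact: (congr1 (@^~ (word2 (inl a) (inr m))) eq_be).
- exact: (congr1 (@^~ (word2 (inr m) (inl a))) eq_be).
- exact: (congr1 (@^~ (word1 m)) eq_ga).
Qed.

(** These are the terms by which a change of section alters a factor set, see [factors_shift]. The
    sign of [h_R] in degree 1 is -1, whence the order of the last difference. *)
Lemma delta_cochain1 (phi : A -> B) (psi : M -> N) :
  delta_rRB (cochain1 phi psi) =
  cochain2 (fun a a' => lact a (phi a') - phi (amul a a') + ract (phi a) a')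
    (fun a m => lact a (psi m) - psi (lact a m) + cr Y (phi a) m)
    (fun m a => cl Y m (phi a) - psi (ract m a) + ract (psi m) a)
    (fun m => S (psi m) - phi (R m)).
Proof.
congr (_, _, _); apply/funext => x.
- by rewrite {1}(word2E x) /delta_AB hochschild1E.
- rewrite {1}(word2E x) /delta_AN num_mod2 sum_contract_word2 behead_word2.
  rewrite belast_word2 /mixed_sum !num_mod1 sqrrN expr1n scale1r.
  by case: (x ord0) (x ord_max) => [?|?] [?|?] /=; rewrite ?addr0.
- by rewrite /h_R expr1 scaleN1r big_ord1 opprB.
Qed.

Lemma delta_AN2E (al : ('I_2 -> A) -> B) (be : ('I_2 -> A + M) -> N) u v w :
  delta_AN al be (word3 u v w) =
  if num_mod (word3 u v w) == 1%N then
    mixed_lact u (mixed_sum al be (word2 v w))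
    - be (word2 (mixed_mul u v) w) + be (word2 u (mixed_mul v w))
    - mixed_ract (mixed_sum al be (word2 u v)) w
  else 0.
Proof.
rewrite /delta_AN sum_contract_word3 behead_word3 belast_word3.
by rewrite -[(-1) ^+ 3]signr_odd /= expr1 scaleN1r addrA.
Qed.

(** One equation on words AAA, one for each of AAM, AMA, MAA, and one for the Rota-Baxter
    operator. *)
Definition cocycle2_eqs (al : A -> A -> B) (bl : A -> M -> N)
    (br : M -> A -> N) (ga : M -> B) : Prop :=
  [/\ forall a b c, lact a (al b c) - al (amul a b) c + al a (amul b c)
        - ract (al a b) c = 0,
      forall a b m, lact a (bl b m) - bl (amul a b) m + bl a (lact b m)
        - cr Y (al a b) m = 0,
      forall a m b, lact a (br m b) - br (lact a m) b + bl a (ract m b)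
        - ract (bl a m) b = 0,
      forall m a b, cl Y m (al a b) - br (ract m a) b + br m (amul a b)
        - ract (br m a) b = 0
    & forall m m', tot_lact m (ga m') - ga (tot_mul m m')
        + tot_ract (ga m) m'
        + (al (R m) (R m') - (S (br m (R m')) + S (bl (R m) m'))) = 0].

Lemma delta_cochain2_eq0 al bl br ga :
  delta_rRB (cochain2 al bl br ga) = 0 <-> cocycle2_eqs al bl br ga.
Proof.
have aB a b c : (delta_rRB (cochain2 al bl br ga)).1.1 (word3 a b c)
    = lact a (al b c) - al (amul a b) c + al a (amul b c) - ract (al a b) c.
  by rewrite /= /delta_AB hochschild2E.
have bN u v w : (delta_rRB (cochain2 al bl br ga)).1.2 (word3 u v w)
   = match u, v, w with
     | inl a, inl b, inr m => lact a (bl b m) - bl (amul a b) m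
         + bl a (lact b m) - cr Y (al a b) m
     | inl a, inr m, inl b => lact a (br m b) - br (lact a m) b
         + bl a (ract m b) - ract (bl a m) b
     | inr m, inl a, inl b => cl Y m (al a b) - br (ract m a) b
         + br m (amul a b) - ract (br m a) b
     | _, _, _ => 0
     end.
  rewrite [LHS]delta_AN2E num_mod3 /mixed_sum !num_mod2.
  by case: u v w => [?|?] [?|?] [?|?].
have gB m m' : (delta_rRB (cochain2 al bl br ga)).2 (word2 m m')
    = tot_lact m (ga m') - ga (tot_mul m m') + tot_ract (ga m) m'
      + (al (R m) (R m') - (S (br m (R m')) + S (bl (R m) m'))).
  rewrite /= [LHS]/GRing.add /= /delta_MB hochschild1E /h_R sqrrN expr1n.
  by rewrite scale1r !big_ord_recl big_ord0 addr0.
split=> [d0|[eq1 eq2 eq3 eq4 eq5]].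
  split=> [a b c|a b m|a m b|m a b|m m'].
  - by rewrite -aB d0.
  - by have := bN (inl a) (inl b) (inr m); rewrite d0.
  - by have := bN (inl a) (inr m) (inl b); rewrite d0.
  - by have := bN (inr m) (inl a) (inl b); rewrite d0.
  - by rewrite -gB d0.
(* The coboundary is displayed as a triple, so that its vanishing is checked component by
   component. *)
rewrite -[LHS]/((delta_rRB (cochain2 al bl br ga)).1.1,
  (delta_rRB (cochain2 al bl br ga)).1.2, (delta_rRB (cochain2 al bl br ga)).2).
congr (_, _, _); apply/funext => x.
- by rewrite (word3E x) aB eq1.
- by rewrite (word3E x) bN; case: (x _) (x _) (x _) => [?|?] [?|?] [?|?].
- by rewrite (word2E x) gB eq5.
Qed.

End LowDegree.

(** * Factor sets of an extension *)

Section FactorSets.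
Variables (k : fieldType) (X : rRBAlg k) (Y : rRBBimod X).
Local Notation A := (rb_alg X).
Local Notation M := (rb_mod X).
Local Notation R := (rb_op X).
Local Notation B := (cB Y).
Local Notation N := (cN Y).
Local Notation S := (cS Y).

Section Extension.
Variable E : abExt X S.
Local Notation Ah := (rb_alg (ext_tot E)).
Local Notation Mh := (rb_mod (ext_tot E)).
Local Notation Rh := (rb_op (ext_tot E)).

Definition iAlg : {linear B -> Ah} := mor_alg (ext_i E).
Definition iMod : {linear N -> Mh} := mor_mod (ext_i E).
Definition pAlg : {linear Ah -> A} := mor_alg (ext_p E).
Definition pMod : {linear Mh -> M} := mor_mod (ext_p E).

Lemma iAlg_inj : injective iAlg.
Proof. by case: (ext_exact_alg E). Qed.

Lemma iMod_inj : injective iMod.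
Proof. by case: (ext_exact_mod E). Qed.

Lemma iAlg_ker x : pAlg x = 0 -> exists b, iAlg b = x.
Proof. by case: (ext_exact_alg E) => _ ex _ /ex. Qed.

Lemma iMod_ker u : pMod u = 0 -> exists n, iMod n = u.
Proof. by case: (ext_exact_mod E) => _ ex _ /ex. Qed.

Lemma pAlg_iAlg b : pAlg (iAlg b) = 0.
Proof. by case: (ext_exact_alg E) => _ ex _; apply/ex; exists b. Qed.

Lemma pMod_iMod n : pMod (iMod n) = 0.
Proof. by case: (ext_exact_mod E) => _ ex _; apply/ex; exists n. Qed.

(** The product is the image under [i] of a product in [zeroRRB], which is 0 by computation. *)
Lemma iAlg_mul b b' : amul (iAlg b) (iAlg b') = 0.
Proof. by rewrite -[LHS](mor_mul (ext_i E) b b') [LHS]linear0. Qed.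

Lemma iMod_lact b n : lact (iAlg b) (iMod n) = 0.
Proof. by rewrite -[LHS](mor_lact (ext_i E) b n) [LHS]linear0. Qed.

Lemma iMod_ract n b : ract (iMod n) (iAlg b) = 0.
Proof. by rewrite -[LHS](mor_ract (ext_i E) n b) [LHS]linear0. Qed.

Lemma op_iMod n : Rh (iMod n) = iAlg (S n).
Proof. exact: esym (mor_op (ext_i E) n). Qed.

Definition factors (s : A -> Ah) (sb : M -> Mh) (al : A -> A -> B)
    (bl : A -> M -> N) (br : M -> A -> N) (ga : M -> B) : Prop :=
  [/\ forall a a', iAlg (al a a') = amul (s a) (s a') - s (amul a a'),
      forall a m, iMod (bl a m) = lact (s a) (sb m) - sb (lact a m),
      forall m a, iMod (br m a) = ract (sb m) (s a) - sb (ract m a)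
    & forall m, iAlg (ga m) = Rh (sb m) - s (R m)].

Lemma factors_uniq s sb al bl br ga al' bl' br' ga' :
  factors s sb al bl br ga -> factors s sb al' bl' br' ga' ->
  cochain2 al bl br ga = cochain2 al' bl' br' ga'.
Proof.
move=> [al1 bl1 br1 ga1] [al2 bl2 br2 ga2].
have <- : al = al'.
  by apply/funext=> a; apply/funext => b; apply: iAlg_inj; rewrite al1 al2.
have <- : bl = bl'.
  by apply/funext=> a; apply/funext => b; apply: iMod_inj; rewrite bl1 bl2.
have <- : br = br'.
  by apply/funext=> a; apply/funext => b; apply: iMod_inj; rewrite br1 br2.
have <- // : ga = ga'.
by apply/funext=> m; apply: iAlg_inj; rewrite ga1 ga2.
Qed.

Lemma sections_exist :
  exists (s : {linear A -> Ah}) (sb : {linear M -> Mh}), is_section s sb.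
Proof.
have [_ _ /(@linear_section k _ _ (pAlg)) [s sK]] := ext_exact_alg E.
have [_ _ /(@linear_section k _ _ (pMod)) [sb sbK]] := ext_exact_mod E.
by exists s, sb.
Qed.

Section ChosenSection.
Variables (s : {linear A -> Ah}) (sb : {linear M -> Mh}).
Hypothesis s_sec : is_section s sb.

Let sK a : pAlg (s a) = a. Proof. exact: s_sec.1. Qed.
Let sbK m : pMod (sb m) = m. Proof. exact: s_sec.2. Qed.

(** The four defects are killed by [p] and [pbar], which are compatible with all the operations; by
    exactness they come from [B] and [N]. *)
Lemma factors_exist : exists al bl br ga, factors s sb al bl br ga.
Proof.
have alP (x : A * A) : exists b,
    iAlg b = amul (s x.1) (s x.2) - s (amul x.1 x.2).
  apply: iAlg_ker; rewrite linearB /= sK [X in X - _]mor_mul.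
  by rewrite -!/(pAlg _) !sK subrr.
have blP (x : A * M) : exists n,
    iMod n = lact (s x.1) (sb x.2) - sb (lact x.1 x.2).
  apply: iMod_ker; rewrite linearB /= sbK [X in X - _]mor_lact.
  by rewrite -!/(pAlg _) -!/(pMod _) sK sbK subrr.
have brP (x : M * A) : exists n,
    iMod n = ract (sb x.1) (s x.2) - sb (ract x.1 x.2).
  apply: iMod_ker; rewrite linearB /= sbK [X in X - _]mor_ract.
  by rewrite -!/(pAlg _) -!/(pMod _) sK sbK subrr.
have gaP m : exists b, iAlg b = Rh (sb m) - s (R m).
  apply: iAlg_ker; rewrite linearB /= sK [X in X - _]mor_op.
  by rewrite -!/(pMod _) sbK subrr.
have [al alE] := choice alP; have [bl blE] := choice blP.
have [br brE] := choice brP; have [ga gaE] := choice gaP.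
exists (fun a b => al (a, b)), (fun a m => bl (a, m)).
exists (fun m a => br (m, a)), ga.
by split=> *; rewrite ?alE ?blE ?brE ?gaE.
Qed.

Hypothesis E_ind : induces E.

Lemma iAlg_lact a b : iAlg (lact a b) = amul (s a) (iAlg b).
Proof. by have [[]] := E_ind s_sec. Qed.

Lemma iAlg_ract b a : iAlg (ract b a) = amul (iAlg b) (s a).
Proof. by have [[]] := E_ind s_sec. Qed.

Lemma iMod_lact_sec a n : iMod (lact a n) = lact (s a) (iMod n).
Proof. by have [[]] := E_ind s_sec. Qed.

Lemma iMod_ract_sec n a : iMod (ract n a) = ract (iMod n) (s a).
Proof. by have [[]] := E_ind s_sec. Qed.

Lemma iMod_cl m b : iMod (cl Y m b) = ract (sb m) (iAlg b).
Proof. by have [_ []] := E_ind s_sec. Qed.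

Lemma iMod_cr b m : iMod (cr Y b m) = lact (iAlg b) (sb m).
Proof. by have [_ []] := E_ind s_sec. Qed.

Definition induceE := (iAlg_lact, iAlg_ract, iMod_lact_sec, iMod_ract_sec,
  iMod_cl, iMod_cr).

(** Everything is tested after the injections [i] and [ibar], which turn the actions on [B] and [N]
    into operations of the extension. The first four equations then express associativity and the
    bimodule laws there, the last one the Rota-Baxter identity at [sb m], [sb m']. *)
Lemma factors_cocycle al bl br ga :
  factors s sb al bl br ga -> cocycle (cochain2 (Y := Y) al bl br ga).
Proof.
move=> [alE blE brE gaE].
(* Each factor is linear in each argument because its defining defect is, and the injections are
   linear. *)
have al_l b : linear (al^~ b).
  move=> c x y; apply: iAlg_inj.
  rewrite linearP /= !alE !(linearPl, linearP) /=.
  by rewrite !(scalerBr, scalerN); zmodule.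
have al_r a : linear (al a).
  move=> c x y; apply: iAlg_inj.
  rewrite linearP /= !alE !(linearPr, linearP) /=.
  by rewrite !(scalerBr, scalerN); zmodule.
have bl_l m : linear (bl^~ m).
  move=> c x y; apply: iMod_inj.
  rewrite linearP /= !blE !(linearPl, linearP) /=.
  by rewrite !(scalerBr, scalerN); zmodule.
have bl_r a : linear (bl a).
  move=> c x y; apply: iMod_inj.
  rewrite linearP /= !blE !(linearPr, linearP) /=.
  by rewrite !(scalerBr, scalerN); zmodule.
have br_l a : linear (br^~ a).
  move=> c x y; apply: iMod_inj.
  rewrite linearP /= !brE !(linearPl, linearP) /=.
  by rewrite !(scalerBr, scalerN); zmodule.
have br_r m : linear (br m).
  move=> c x y; apply: iMod_inj.
  rewrite linearP /= !brE !(linearPr, linearP) /=.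
  by rewrite !(scalerBr, scalerN); zmodule.
have ga_lin : linear ga.
  move=> c x y; apply: iAlg_inj.
  rewrite linearP /= !gaE !linearP /=.
  by rewrite !(scalerBr, scalerN); zmodule.
split.
  apply/is_cochain2P; exists (bilinear_pack al_l al_r).
  exists (bilinear_pack bl_l bl_r), (bilinear_pack br_l br_r).
  by exists (linear_pack ga_lin).
apply/delta_cochain2_eq0; split=> [a b c|a b m|a m b|m a b|m m'].
- apply: iAlg_inj; rewrite !(linearB, linearD, linear0) /= !induceE !alE.
  rewrite !(linearBr, linearBl) /= !amulA; zmodule.
- apply: iMod_inj; rewrite !(linearB, linearD, linear0) /= !induceE !alE !blE.
  rewrite !(linearBr, linearBl) /= !lact_mul; zmodule.
- apply: iMod_inj; rewrite !(linearB, linearD, linear0) /= !induceE !brE !blE.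
  rewrite !(linearBr, linearBl) /= !lact_ract; zmodule.
- apply: iMod_inj; rewrite !(linearB, linearD, linear0) /= !induceE !alE !brE.
  rewrite !(linearBr, linearBl) /= !ract_mul; zmodule.
(* This coboundary is - i (ga m) * i (ga m'), and B has zero product. *)
- have := iAlg_mul (ga m) (ga m').
  rewrite !gaE !(linearBr, linearBl) rb_opP linearD /= => gg0.
  apply: iAlg_inj; rewrite /tot_lact /tot_ract /tot_mul.
  rewrite !(linearB, linearD, linear0) /= -!op_iMod !induceE.
  rewrite !gaE !alE !blE !brE.
  rewrite rb_opP !(linearBr, linearBl) !(linearB, linearD) /=.
  rewrite -[RHS]oppr0 -gg0; zmodule.
Qed.

(** Expanding the defects of the new section, the terms of first order in [phi], [psi] give the
    coboundary, and those of second order vanish since [B] has zero product and acts by zero on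
    [N]. *)
Lemma factors_shift al bl br ga (phi : A -> B) (psi : M -> N)
    (s' : A -> Ah) (sb' : M -> Mh) :
    (forall a, s' a = s a + iAlg (phi a)) ->
    (forall m, sb' m = sb m + iMod (psi m)) ->
  factors s sb al bl br ga ->
  factors s' sb'
    (fun a b => al a b
      + (lact a (phi b) - phi (amul a b) + ract (phi a) b))
    (fun a m => bl a m
      + (lact a (psi m) - psi (lact a m) + cr Y (phi a) m))
    (fun m a => br m a
      + (cl Y m (phi a) - psi (ract m a) + ract (psi m) a))
    (fun m => ga m + (S (psi m) - phi (R m))).
Proof.
move=> s'E sb'E [alE blE brE gaE]; split=> [a b|a m|m a|m].
- rewrite !s'E !(linearB, linearD) /= !induceE !alE !(linearDr, linearDl) /=.
  rewrite iAlg_mul; zmodule.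
- rewrite !s'E !sb'E !(linearB, linearD) /= !induceE !blE.
  rewrite !(linearDr, linearDl) /= iMod_lact; zmodule.
- rewrite !s'E !sb'E !(linearB, linearD) /= !induceE !brE.
  rewrite !(linearDr, linearDl) /= iMod_ract; zmodule.
- by rewrite !s'E !sb'E !(linearB, linearD) /= gaE op_iMod; zmodule.
Qed.

End ChosenSection.
End Extension.
End FactorSets.

(** * The extension defined by a cocycle *)

Section TwistedExtension.
Variables (k : fieldType) (X : rRBAlg k) (Y : rRBBimod X).
Local Notation A := (rb_alg X).
Local Notation M := (rb_mod X).
Local Notation R := (rb_op X).
Local Notation B := (cB Y).
Local Notation N := (cN Y).
Local Notation S := (cS Y).
Variables (al : {bilinear A -> A -> B}) (bl : {bilinear A -> M -> N}).
Variables (br : {bilinear M -> A -> N}) (ga : {linear M -> B}).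
Hypothesis eqs : cocycle2_eqs al bl br ga.

Local Notation AB := (A * B)%type.
Local Notation MN := (M * N)%type.

(** The formula comes from multiplying [s a + i b] by [s a' + i b'] in an extension with factor
    [al]; there is no term in both [b] and [b']. *)
Definition twisted_mul (x y : AB) : AB :=
  (amul x.1 y.1, lact x.1 y.2 + ract x.2 y.1 + al x.1 y.1).

Definition twisted_lact (x : AB) (u : MN) : MN :=
  (lact x.1 u.1, lact x.1 u.2 + cr Y x.2 u.1 + bl x.1 u.1).

Definition twisted_ract (u : MN) (x : AB) : MN :=
  (ract u.1 x.1, cl Y u.1 x.2 + ract u.2 x.1 + br u.1 x.1).

Definition twisted_op (u : MN) : AB := (R u.1, S u.2 + ga u.1).

Lemma twisted_mul_linl y : linear (twisted_mul^~ y).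
Proof.
move=> c x x'; congr pair; rewrite /= ?linearPl //.
by rewrite !scalerDr; zmodule.
Qed.

Lemma twisted_mul_linr x : linear (twisted_mul x).
Proof.
move=> c y y'; congr pair; rewrite /= ?linearPr //.
by rewrite !scalerDr; zmodule.
Qed.

Lemma twisted_lact_linl u : linear (twisted_lact^~ u).
Proof.
move=> c x x'; congr pair; rewrite /= ?linearPl //.
by rewrite !scalerDr; zmodule.
Qed.

Lemma twisted_lact_linr x : linear (twisted_lact x).
Proof.
move=> c y y'; congr pair; rewrite /= ?linearPr //.
by rewrite !scalerDr; zmodule.
Qed.

Lemma twisted_ract_linl x : linear (twisted_ract^~ x).
Proof.
move=> c u u'; congr pair; rewrite /= ?linearPl //.
by rewrite !scalerDr; zmodule.
Qed.

Lemma twisted_ract_linr u : linear (twisted_ract u).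
Proof.
move=> c y y'; congr pair; rewrite /= ?linearPr //.
by rewrite !scalerDr; zmodule.
Qed.

Lemma twisted_op_linear : linear twisted_op.
Proof.
move=> c u u'; congr pair; rewrite /= !linearP //=.
by rewrite scalerDr; zmodule.
Qed.

Definition twisted_mul_bilinear : {bilinear AB -> AB -> AB} :=
  bilinear_pack twisted_mul_linl twisted_mul_linr.

(** In the second component the bimodule laws cancel all terms without [al], and the rest is the
    opposite of the first cocycle equation. The three laws of [twisted_mod] hold likewise by the
    next three equations. *)
Lemma twisted_mulA x y z :
  twisted_mul (twisted_mul x y) z = twisted_mul x (twisted_mul y z).
Proof.
case: eqs => e1 _ _ _ _; congr pair; rewrite /= ?amulA //.
apply: subr0_eq; rewrite !(linearDl, linearDr) /=.
rewrite lact_mul lact_ract ract_mul -[RHS]oppr0 -(e1 x.1 y.1 z.1).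
by zmodule.
Qed.

Definition twisted_alg : assocAlg k :=
  @AssocAlg k AB twisted_mul_bilinear twisted_mulA.

Lemma twisted_lact_mul x y u :
  twisted_lact (twisted_mul x y) u = twisted_lact x (twisted_lact y u).
Proof.
case: eqs => _ e2 _ _ _; congr pair; rewrite /= ?lact_mul //.
apply: subr0_eq; rewrite !(linearDl, linearDr) /=.
rewrite cr_blact cr_lact -[RHS]oppr0 -(e2 x.1 y.1 u.1).
by zmodule.
Qed.

Lemma twisted_lact_ract x u y :
  twisted_ract (twisted_lact x u) y = twisted_lact x (twisted_ract u y).
Proof.
case: eqs => _ _ e3 _ _; congr pair; rewrite /= ?lact_ract //.
apply: subr0_eq; rewrite !(linearDl, linearDr) /=.
rewrite lact_ract cl_lact cr_ract -[RHS]oppr0 -(e3 x.1 u.1 y.1).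
by zmodule.
Qed.

Lemma twisted_ract_mul u x y :
  twisted_ract (twisted_ract u x) y = twisted_ract u (twisted_mul x y).
Proof.
case: eqs => _ _ _ e4 _; congr pair; rewrite /= ?ract_mul //.
apply: subr0_eq; rewrite !(linearDl, linearDr) /=.
rewrite ract_mul cl_ract cl_bract -[RHS]oppr0 -(e4 u.1 x.1 y.1).
by zmodule.
Qed.

Definition twisted_mod : bimodule twisted_alg :=
  @Bimodule k twisted_alg MN
    (bilinear_pack twisted_lact_linl twisted_lact_linr)
    (bilinear_pack twisted_ract_linl twisted_ract_linr)
    twisted_lact_mul twisted_lact_ract twisted_ract_mul.

(** The terms in [N] alone cancel by [cS_lact] and [cS_ract]; those in [ga] assemble into
    [tot_lact], [tot_ract] and [tot_mul], leaving the last cocycle equation. *)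
Lemma twisted_opP (u u' : MN) :
  twisted_mul (twisted_op u) (twisted_op u')
  = twisted_op (twisted_lact (twisted_op u) u'
                + twisted_ract u (twisted_op u')).
Proof.
case: eqs => _ _ _ _ e5; congr pair; rewrite /= ?rb_opP //.
apply: subr0_eq; have := e5 u.1 u'.1; rewrite /tot_lact /tot_ract /tot_mul.
rewrite !(linearDl, linearDr, linearD, linearB) /= cS_lact cS_ract.
by rewrite !linearD /= => <-; zmodule.
Qed.

Definition twisted_rRB : rRBAlg k :=
  @RRBAlg k twisted_alg twisted_mod (linear_pack twisted_op_linear) twisted_opP.

Lemma twisted_inl_linear (U V : lmodType k) :
  linear (fun v : V => (0, v) : (U * V)%type).
Proof. by move=> c v v'; congr pair; rewrite /= scaler0 addr0. Qed.

Lemma twisted_fst_linear (U V : lmodType k) : linear (@fst U V).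
Proof. by []. Qed.

(** The morphism laws of [twisted_i], with the operations of [zeroRRB] already evaluated to 0. *)
Fact twisted_i_subproof :
  [/\ forall b b' : B, (0, 0) = twisted_mul (0, b) (0, b'),
      forall (b : B) (n : N), (0, 0) = twisted_lact (0, b) (0, n),
      forall (n : N) (b : B), (0, 0) = twisted_ract (0, n) (0, b)
    & forall n : N, (0, S n) = twisted_op (0, n)].
Proof.
by split=> *; congr pair; rewrite /= ?linear0 ?(linear0l, linear0r) ?addr0.
Qed.

Let iP := twisted_i_subproof.

Definition twisted_i : rRBMorph (zeroRRB S) twisted_rRB :=
  @RRBMorph k (zeroRRB S) twisted_rRB
    (linear_pack (@twisted_inl_linear A B))
    (linear_pack (@twisted_inl_linear M N))
    (let: And4 p _ _ _ := iP in p) (let: And4 _ p _ _ := iP in p)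
    (let: And4 _ _ p _ := iP in p) (let: And4 _ _ _ p := iP in p).

Definition twisted_p : rRBMorph twisted_rRB X :=
  @RRBMorph k twisted_rRB X
    (linear_pack (@twisted_fst_linear A B))
    (linear_pack (@twisted_fst_linear M N))
    (fun _ _ => erefl) (fun _ _ => erefl) (fun _ _ => erefl) (fun _ => erefl).

Lemma pair_short_exact (U V : lmodType k) :
  short_exact (fun v : V => (0, v) : (U * V)%type) (@fst U V).
Proof.
split=> [v v' [//]|[u v]|u]; last by exists (u, 0).
by split=> [/= ->|[v' [<-]]//]; exists v.
Qed.

Definition twisted_ext : abExt X S :=
  @AbExt k X N B S twisted_rRB twisted_i twisted_p
    (@pair_short_exact A B) (@pair_short_exact M N).

(** A section is the identity in its first component, and its second component does not affect
    operations with elements [(0, b)] or [(0, n)]. *)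
Lemma twisted_induces : induces (Y := Y) twisted_ext.
Proof.
move=> s sb [sK sbK] i ib.
have {}sK a : (s a).1 = a by exact: sK.
have {}sbK m : (sb m).1 = m by exact: sbK.
split; first split; last split; move=> x y; congr pair;
  by rewrite /= ?(sK, sbK) ?linear0l ?linear0r ?addr0 ?add0r.
Qed.

(** The inclusions of [A] and [M] as first summands are the required section. *)
Lemma twisted_factors :
  exists (s : {linear A -> rb_alg (ext_tot twisted_ext)})
    (sb : {linear M -> rb_mod (ext_tot twisted_ext)}),
    is_section (Y := Y) s sb /\ factors (Y := Y) s sb al bl br ga.
Proof.
have inl_lin (U V : lmodType k) : linear (fun u : U => (u, 0) : (U * V)%type).
  by move=> c v v'; congr pair; rewrite /= scaler0 addr0.
exists (linear_pack (inl_lin A B)), (linear_pack (inl_lin M N)).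
split; first by [].
split=> *; congr pair;
  by rewrite /= ?linear0 ?linear0l ?linear0r ?subrr ?oppr0 ?add0r ?addr0.
Qed.

(** * Comparison of an extension with the one twisted by its factor set *)

Section Comparison.
Variables (E : abExt X S).
Variables (s : {linear A -> rb_alg (ext_tot E)}).
Variables (sb : {linear M -> rb_mod (ext_tot E)}).
Hypotheses (E_ind : induces E) (s_sec : is_section s sb).
Hypothesis s_fac : factors (Y := Y) s sb al bl br ga.

Let phi (x : AB) : rb_alg (ext_tot E) := s x.1 + iAlg E x.2.
Let psi (u : MN) : rb_mod (ext_tot E) := sb u.1 + iMod E u.2.

Lemma compare_alg_linear : linear phi.
Proof.
by move=> c x y; rewrite /phi /= !linearP scalerDr /=; zmodule.
Qed.

Lemma compare_mod_linear : linear psi.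
Proof.
by move=> c x y; rewrite /psi /= !linearP scalerDr /=; zmodule.
Qed.

Lemma compare_mul x y : phi (twisted_mul x y) = amul (phi x) (phi y).
Proof.
case: s_fac => alE _ _ _; rewrite /phi /= !linearD /=.
rewrite (iAlg_lact s_sec E_ind) (iAlg_ract s_sec E_ind) alE.
by rewrite !(linearDl, linearDr) /= iAlg_mul; zmodule.
Qed.

Lemma compare_lact x u : psi (twisted_lact x u) = lact (phi x) (psi u).
Proof.
case: s_fac => _ blE _ _; rewrite /phi /psi /= !linearD /=.
rewrite (iMod_lact_sec s_sec E_ind) (iMod_cr s_sec E_ind) blE.
by rewrite !(linearDl, linearDr) /= iMod_lact; zmodule.
Qed.

Lemma compare_ract u x : psi (twisted_ract u x) = ract (psi u) (phi x).
Proof.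
case: s_fac => _ _ brE _; rewrite /phi /psi /= !linearD /=.
rewrite (iMod_cl s_sec E_ind) (iMod_ract_sec s_sec E_ind) brE.
by rewrite !(linearDl, linearDr) /= iMod_ract; zmodule.
Qed.

Lemma compare_op u : phi (twisted_op u) = rb_op (ext_tot E) (psi u).
Proof.
case: s_fac => _ _ _ gaE; rewrite /phi /psi /= !linearD /=.
by rewrite gaE op_iMod; zmodule.
Qed.

Definition compare_mor : rRBMorph twisted_rRB (ext_tot E) :=
  @RRBMorph k twisted_rRB (ext_tot E) (linear_pack compare_alg_linear)
    (linear_pack compare_mod_linear)
    compare_mul compare_lact compare_ract compare_op.

(** As in the short five lemma: applying the projection recovers the first coordinate, and
    [x - s (p x)], being in the kernel, comes from the second. *)
Lemma twisted_iso : abExt_iso twisted_ext E.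
Proof.
case: (s_sec) => sK sbK; exists compare_mor; split=> /=.
- split; apply: inj_surj_bijective; [move=> [a b] [a' b'] | move=> x |
    move=> [m n] [m' n'] | move=> u].
  + rewrite /= /phi /= => eq_ab.
    have eq_a : a = a'.
      have := congr1 (pAlg E) eq_ab.
      by rewrite !linearD /= !pAlg_iAlg !addr0 /pAlg !sK.
    by move: eq_ab; rewrite eq_a => /addrI /iAlg_inj ->.
  + have [b ib] : exists b, iAlg E b = x - s (pAlg E x).
      by apply: iAlg_ker; rewrite linearB [X in _ - X]sK subrr.
    by exists (pAlg E x, b); rewrite /= /phi /= ib addrC subrK.
  + rewrite /= /psi /= => eq_mn.
    have eq_m : m = m'.
      have := congr1 (pMod E) eq_mn.
      by rewrite !linearD /= !pMod_iMod !addr0 /pMod !sbK.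
    by move: eq_mn; rewrite eq_m => /addrI /iMod_inj ->.
  + have [n ibn] : exists n, iMod E n = u - sb (pMod E u).
      by apply: iMod_ker; rewrite linearB [X in _ - X]sbK subrr.
    by exists (pMod E u, n); rewrite /= /psi /= ibn addrC subrK.
- by move=> b; rewrite /phi /= linear0 add0r.
- by move=> n; rewrite /psi /= linear0 add0r.
- by move=> x; rewrite linearD /= sK [X in _ + X]pAlg_iAlg addr0.
- by move=> u; rewrite linearD /= sbK [X in _ + X]pMod_iMod addr0.
Qed.

End Comparison.
End TwistedExtension.

(** * Classification *)

Section Isomorphisms.
Variables (k : fieldType) (X : rRBAlg k) (N B : lmodType k).
Variable S : {linear N -> B}.
Implicit Types E : abExt X S.

Lemma abExt_iso_refl E : abExt_iso E E.
Proof.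
pose f := @RRBMorph k (ext_tot E) (ext_tot E) idfun idfun
  (fun _ _ => erefl) (fun _ _ => erefl) (fun _ _ => erefl) (fun _ => erefl).
by exists f; split=> //; split; exists idfun.
Qed.

Lemma abExt_iso_sym E E' : abExt_iso E E' -> abExt_iso E' E.
Proof.
move=> [f [[[g fK gK] [h fbK hK]] fi fib pf pfb]].
have g_lin : linear g.
  by move=> c x y; apply: (can_inj fK); rewrite linearP /= !gK.
have h_lin : linear h.
  by move=> c x y; apply: (can_inj fbK); rewrite linearP /= !hK.
have gM x y : g (amul x y) = amul (g x) (g y).
  by apply: (can_inj fK); rewrite mor_mul !gK.
have hL x u : h (lact x u) = lact (g x) (h u).
  by apply: (can_inj fbK); rewrite mor_lact !gK !hK.
have hR u x : h (ract u x) = ract (h u) (g x).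
  by apply: (can_inj fbK); rewrite mor_ract !gK !hK.
have gO u : g (rb_op (ext_tot E') u) = rb_op (ext_tot E) (h u).
  by apply: (can_inj fK); rewrite mor_op !gK !hK.
exists (@RRBMorph k (ext_tot E') (ext_tot E) (linear_pack g_lin)
  (linear_pack h_lin) gM hL hR gO); split=> [|b|n|x|u] /=.
- by split; [exists (mor_alg f)|exists (mor_mod f)].
- by rewrite -fi fK.
- by rewrite -fib fbK.
- by rewrite -pf gK.
- by rewrite -pfb hK.
Qed.

Lemma abExt_iso_trans E1 E2 E3 :
  abExt_iso E1 E2 -> abExt_iso E2 E3 -> abExt_iso E1 E3.
Proof.
move=> [f [[f1 f2] fi fib pf pfb]] [g [[g1 g2] gi gib pg pgb]].
have gfM x y : (mor_alg g \o mor_alg f) (amul x y)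
    = amul ((mor_alg g \o mor_alg f) x) ((mor_alg g \o mor_alg f) y).
  by rewrite /= !mor_mul.
have gfL x u : (mor_mod g \o mor_mod f) (lact x u)
    = lact ((mor_alg g \o mor_alg f) x) ((mor_mod g \o mor_mod f) u).
  by rewrite /= !mor_lact.
have gfR u x : (mor_mod g \o mor_mod f) (ract u x)
    = ract ((mor_mod g \o mor_mod f) u) ((mor_alg g \o mor_alg f) x).
  by rewrite /= !mor_ract.
have gfO u : (mor_alg g \o mor_alg f) (rb_op (ext_tot E1) u)
    = rb_op (ext_tot E3) ((mor_mod g \o mor_mod f) u).
  by rewrite /= !mor_op.
exists (@RRBMorph k (ext_tot E1) (ext_tot E3) (mor_alg g \o mor_alg f)
  (mor_mod g \o mor_mod f) gfM gfL gfR gfO); split=> [|b|n|x|u] /=.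
- by split; apply: bij_comp.
- by rewrite fi gi.
- by rewrite fib gib.
- by rewrite pg pf.
- by rewrite pgb pfb.
Qed.

Lemma abExt_iso_class E E' : abExt_iso E E' -> abExt_iso E = abExt_iso E'.
Proof.
move=> EE'; apply/funext => E''; apply/propext.
split; apply: abExt_iso_trans => //.
exact: abExt_iso_sym.
Qed.

End Isomorphisms.

(** * From isomorphism classes to cohomology classes *)

Section Classification.
Variables (k : fieldType) (X : rRBAlg k) (Y : rRBBimod X).
Implicit Types (E : abExt X (cS Y)) (c : precochain Y 2).

(** A relation and not a map, since each section of [E] yields its own cochain. *)
Definition factor_set E c : Prop :=
  exists s sb, is_section (Y := Y) (E := E) s sb /\
  exists al bl br ga, c = cochain2 al bl br ga /\
    factors (Y := Y) s sb al bl br ga.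

Lemma factor_set_exists E : exists c, factor_set E c.
Proof.
have [s [sb sec]] := sections_exist E.
have [al [bl [br [ga fac]]]] := factors_exist sec.
by exists (cochain2 al bl br ga), s, sb; split=> //; exists al, bl, br, ga.
Qed.

Lemma factor_set_cocycle E c : induces E -> factor_set E c -> cocycle c.
Proof.
move=> E_ind [s [sb [sec [al [bl [br [ga [-> fac]]]]]]]].
exact: (factors_cocycle sec E_ind fac).
Qed.

Lemma cocycle_factor_set c :
  cocycle c -> exists2 E, induces E & factor_set E c.
Proof.
move=> [/is_cochain2P[al [bl [br [ga ->]]]] /delta_cochain2_eq0 eqs].
exists (twisted_ext eqs); first exact: twisted_induces.
have [s [sb [sec fac]]] := twisted_factors eqs.
by exists s, sb; split=> //; exists al, bl, br, ga.
Qed.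

(** Composing a section of [E] with the isomorphism gives a section of [E'] with the same defects,
    as the isomorphism carries the inclusions of [E] to those of [E']. *)
Lemma factor_set_iso E E' c :
  abExt_iso E E' -> factor_set E c -> factor_set E' c.
Proof.
move=> [f [_ fi fib pf pfb]] [s [sb [[sK sbK] [al [bl [br [ga [-> fac]]]]]]]].
exists (mor_alg f \o s), (mor_mod f \o sb); split.
  by split=> x /=; rewrite (pf, pfb).
exists al, bl, br, ga; split=> //; case: fac => alE blE brE gaE.
split=> [a b|a m|m a|m] /=.
- by rewrite -[LHS]fi -mor_mul -linearB -alE.
- by rewrite -[LHS]fib -mor_lact -linearB -blE.
- by rewrite -[LHS]fib -mor_ract -linearB -brE.
- by rewrite -[LHS]fi -mor_op -linearB -gaE.
Qed.

Lemma factor_set_twisted_iso E (al : {bilinear rb_alg X -> rb_alg X -> cB Y})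
    (bl : {bilinear rb_alg X -> rb_mod X -> cN Y})
    (br : {bilinear rb_mod X -> rb_alg X -> cN Y})
    (ga : {linear rb_mod X -> cB Y}) (eqs : cocycle2_eqs al bl br ga) :
  induces E -> factor_set E (cochain2 al bl br ga) ->
  abExt_iso (twisted_ext eqs) E.
Proof.
move=> E_ind [s [sb [sec [al' [bl' [br' [ga' [eq_c fac]]]]]]]].
apply: (twisted_iso eqs E_ind sec).
have [eq_al eq_bl eq_br eq_ga] := cochain2_inj eq_c.
by case: fac; split=> *; rewrite ?(eq_al, eq_bl, eq_br, eq_ga).
Qed.

(** Both are isomorphic to the extension twisted by [c]. *)
Lemma same_factor_set_iso E E' c : induces E -> induces E' ->
  factor_set E c -> factor_set E' c -> abExt_iso E E'.
Proof.
move=> E_ind E'_ind Ec E'c; have cc := factor_set_cocycle E_ind Ec.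
(* A factor set consists of bare functions; being a cochain supplies the bilinear maps that
   [twisted_ext] requires. *)
case: (cc) => /is_cochain2P[al [bl [br [ga def_c]]]] d0.
rewrite def_c in Ec E'c d0; have /delta_cochain2_eq0 eqs := d0.
apply: abExt_iso_trans (factor_set_twisted_iso eqs E'_ind E'c).
exact: abExt_iso_sym (factor_set_twisted_iso eqs E_ind Ec).
Qed.

Lemma factor_setE E c : induces E -> factor_set E c ->
  factor_set E = fun c' => coboundary (c' - c).
Proof.
move=> E_ind [s [sb [sec [al [bl [br [ga [-> fac]]]]]]]].
apply/funext => c'; apply/propext; split.
  move=> [s' [sb' [sec' [al' [bl' [br' [ga' [-> fac']]]]]]]].
  (* Two sections differ by maps into the kernels, that is, by a 1-cochain. *)
  have phiP a : exists b, iAlg E b = s' a - s a.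
    apply: iAlg_ker; rewrite linearB.
    by rewrite [X in X - _](sec'.1 a) [X in _ - X](sec.1 a) subrr.
  have psiP m : exists n, iMod E n = sb' m - sb m.
    apply: iMod_ker; rewrite linearB.
    by rewrite [X in X - _](sec'.2 m) [X in _ - X](sec.2 m) subrr.
  have [phi phiE] := choice phiP; have [psi psiE] := choice psiP.
  have phi_lin : linear phi.
    move=> x a b; apply: (@iAlg_inj _ _ _ E).
    rewrite linearP /= !phiE !linearP /=.
    by rewrite !(scalerBr, scalerN); zmodule.
  have psi_lin : linear psi.
    move=> x m n; apply: (@iMod_inj _ _ _ E).
    rewrite linearP /= !psiE !linearP /=.
    by rewrite !(scalerBr, scalerN); zmodule.
  exists (cochain1 (linear_pack phi_lin) (linear_pack psi_lin)).
    by apply/is_cochain1P; exists (linear_pack phi_lin), (linear_pack psi_lin).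
  apply/eqP; rewrite subr_eq addrC; apply/eqP.
  (* Both sides are factor sets of the one section [s'], [sb'], hence equal. *)
  rewrite delta_cochain1 [RHS]cochain2D; apply: factors_uniq fac' _.
  apply: (factors_shift sec E_ind _ _ fac) => x.
    by rewrite [X in _ + X]phiE addrC subrK.
  by rewrite [X in _ + X]psiE addrC subrK.
(* Conversely, moving the section by a 1-cochain realises its coboundary. *)
move=> [b /is_cochain1P[phi [psi ->]]].
move=> /eqP; rewrite subr_eq addrC => /eqP ->.
rewrite delta_cochain1 [X in factor_set _ X]cochain2D.
exists (s \+ (iAlg E \o phi)), (sb \+ (iMod E \o psi)); split.
  split=> x; rewrite linearD /=.
    by rewrite [X in X + _](sec.1 x) [X in _ + X]pAlg_iAlg addr0.
  by rewrite [X in X + _](sec.2 x) [X in _ + X]pMod_iMod addr0.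
do 4!eexists; split; first by [].
exact: (factors_shift sec E_ind _ _ fac).
Qed.

(** The union over the whole class makes the correspondence independent of a representative. *)
Definition class_factor_sets (K : abExt X (cS Y) -> Prop) c : Prop :=
  exists2 E, K E & factor_set E c.

Lemma class_factor_setsE E : class_factor_sets (abExt_iso E) = factor_set E.
Proof.
apply/funext => c; apply/propext; split=> [[E' EE']|Ec].
  by apply: factor_set_iso; exact: abExt_iso_sym.
by exists E => //; exact: abExt_iso_refl.
Qed.

Lemma class_factor_sets_coset K : (exists2 E, induces E & K = abExt_iso E) ->
  exists2 z, cocycle z & class_factor_sets K = fun z' => coboundary (z' - z).
Proof.
move=> [E E_ind ->]; have [z Ez] := factor_set_exists E.
exists z; first exact: factor_set_cocycle Ez.
by rewrite class_factor_setsE (factor_setE E_ind Ez).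
Qed.

Definition cohomology_class (K : Ext Y) : cohomology Y 2 :=
  exist _ (class_factor_sets (sval K)) (class_factor_sets_coset (svalP K)).

Lemma cohomology_class_inj : injective cohomology_class.
Proof.
move=> [K1 K1P] [K2 K2P] /(congr1 sval) /= eq12; apply: eq_exist.
case: K1P K2P => [E1 E1_ind def1] [E2 E2_ind def2].
move: eq12; rewrite def1 def2 !class_factor_setsE => eq12.
(* Equal cosets mean that any factor set of [E1] is also one of [E2]. *)
have [c E1c] := factor_set_exists E1; apply: abExt_iso_class.
by apply: (same_factor_set_iso E1_ind E2_ind E1c); rewrite -eq12.
Qed.

Lemma cohomology_class_surj h : exists K, cohomology_class K = h.
Proof.
case: h => H HP; case: (HP) => z z_coc defH.
(* The preimage is the class of an extension having the representative [z] as factor set. *)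
have [E E_ind Ez] := cocycle_factor_set z_coc.
have KP : exists2 E', induces E' & abExt_iso E = abExt_iso E' by exists E.
exists (exist _ (abExt_iso E) KP); apply: eq_exist => /=.
by rewrite class_factor_setsE (factor_setE E_ind Ez) defH.
Qed.

End Classification.

Theorem theorem5p3 (k : fieldType) (char0 : [pchar k] =i pred0)
    (X : rRBAlg k) (Y : rRBBimod X) :
  exists f : Ext Y -> cohomology Y 2, bijective f.
Proof.
exists (@cohomology_class k X Y).
exact: inj_surj_bijective (@cohomology_class_inj k X Y)
  (@cohomology_class_surj k X Y).
Qed.
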